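(* For every instance of the Colored Knapsack Problem, the linear program $\text{LP}_{\text{CKP}}$ (the linear relaxation of the CKP integer program, defined in the context) has an optimal solution $\boldsymbol{x}^*\in[0,1]^n$ in which at most two items are fractionally packed, i.e., $\big|\{i\in\mathcal{I} \mid x^*_i\in(0,1)\}\big|\le 2$.
   Context: An instance of the Colored Knapsack Problem (CKP) consists of a set of items $\mathcal{I}=\{1,\dots,n\}$ with profits $p_i\in\mathbb{Z}$ (zero and negative profits allowed) and weights $w_i\in\mathbb{Z}_{>0}$, a capacity $b\in\mathbb{Z}_{>0}$ with $b<\sum_{i=1}^n w_i$, a set of colors $\mathcal{C}=\{1,\dots,m\}$, and a color $\kappa_i\in\mathcal{C}$ for each item $i$. For $c\in\mathcal{C}$ let $\mathcal{I}_c=\{i\in\mathcal{I}\mid \kappa_i=c\}$ and $\bar{\mathcal{I}}_c=\mathcal{I}\setminus\mathcal{I}_c$. $\text{LP}_{\text{CKP}}$ is the linear program: maximize $\sum_{i\in\mathcal{I}}p_ix_i$ subject to $\sum_{i\in\mathcal{I}}w_ix_i\le b$; $\sum_{i\in\mathcal{I}_c}x_i-\sum_{i\in\bar{\mathcal{I}}_c}x_i\le 1$ for all $c\in\mathcal{C}$; and $0\le x_i\le 1$ for all $i\in\mathcal{I}$. *)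

(* Defs.v *)
From HB Require Import structures.
From mathcomp Require Import all_boot all_order all_algebra.
From mathcomp Require Import reals.

Set Implicit Arguments.
Unset Strict Implicit.
Unset Printing Implicit Defensive.

Import Order.TTheory GRing.Theory Num.Theory.
Local Open Scope ring_scope.

(* Items {1, ..., n} and colors {1, ..., m} are indexed by 'I_n and 'I_m. *)
Record ckp_instance (n m : nat) := CKPInstance {
  profit : 'I_n -> int;
  weight : 'I_n -> int;
  capacity : int;
  color : 'I_n -> 'I_m;
  weight_gt0 : forall i, 0 < weight i;
  capacity_gt0 : 0 < capacity;
  capacity_lt_sum_weight : capacity < \sum_(i < n) weight i
}.

Definition color_class n m (K : ckp_instance n m) (c : 'I_m) : {set 'I_n} :=
  [set i | color K i == c].

Section LinearRelaxation.
Variables (R : realType) (n m : nat) (K : ckp_instance n m).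
Implicit Types x : 'rV[R]_n.

Definition lp_objective x : R := \sum_(i < n) (profit K i)%:~R * x 0 i.

Definition lp_feasible x : Prop :=
  [/\ \sum_(i < n) (weight K i)%:~R * x 0 i <= (capacity K)%:~R,
      forall c : 'I_m,
        \sum_(i in color_class K c) x 0 i
          - \sum_(i in ~: color_class K c) x 0 i <= 1
    & forall i : 'I_n, 0 <= x 0 i <= 1].

Definition lp_optimal x : Prop :=
  lp_feasible x /\ forall y, lp_feasible y -> lp_objective y <= lp_objective x.

End LinearRelaxation.

Definition fractional_items (R : realType) n (x : 'rV[R]_n) : {set 'I_n} :=
  [set i | 0 < x 0 i < 1].

(* Main.v *)
Require Import Defs.
From HB Require Import structures.
From mathcomp Require Import boolp classical_sets reals.
From mathcomp Require Import all_boot all_order all_algebra.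

(** Two facts combine.

    First, a system of finitely many linear inequalities that is feasible and
    has no recession direction attains the maximum of any linear objective at
    a vertex, that is, at a feasible point which is the only solution of the
    equations of its tight constraints ([lp_vertex_optimum]). From a feasible
    point that is not a vertex one can move, without losing objective value,
    along a direction that preserves all tight constraints, until a further
    constraint becomes tight ([tighten]); this stops at a vertex
    ([vertex_dominates]). A vertex is determined by its set of tight
    constraints, so there are finitely many vertices and one of them is best.
    The argument works over any ordered field: it uses no compactness.

    Second, at a vertex of a polyhedron in dimension n at least n constraints
    are tight ([dim_le_tight]). For the colored knapsack, two color constraints
    are never tight together: adding the ones of distinct colors c and c' gives
    -2 times the sum of the x_i over the items of all other colors on the left
    and 2 on the right ([tight_color_unique]). So besides the bounds on the
    variables at most two constraints are tight, the capacity and one color.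
    A bound is tight for at most one side of each non-fractional item and for
    no fractional one, whence n <= 2 + (n - number of fractional items). *)

Set Implicit Arguments.
Unset Strict Implicit.
Unset Printing Implicit Defensive.

Import Order.TTheory GRing.Theory Num.Theory.
Local Open Scope ring_scope.

(** * Vertices of systems of linear inequalities *)

Section Vertices.
Variables (R : realFieldType) (V : lmodType R) (J : finType).
Variables (a : J -> {scalar V}) (b : J -> R).
Implicit Types (x d : V) (j : J) (p : {scalar V}).

Definition feasible x := forall j, a j x <= b j.

Definition tight x : {set J} := [set j | a j x == b j].

Definition vertex x :=
  feasible x /\ forall d, (forall j, j \in tight x -> a j d = 0) -> d = 0.

(** The difference of two vertices with the same tight constraints is
    annihilated by all of these constraints. *)
Lemma tight_vertex_inj x y : vertex x -> vertex y -> tight x = tight y -> x = y.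
Proof.
move=> [_ rigx] _ eqT; apply/eqP; rewrite -subr_eq0; apply/eqP/rigx => j jx.
have := jx; rewrite eqT inE => /eqP ayj.
by move: jx; rewrite inE linearB /= ayj => /eqP ->; rewrite subrr.
Qed.

Hypothesis no_recession : forall d, (forall j, a j d <= 0) -> d = 0.

(** The point y is where the ray from x in the direction d leaves the feasible
    set; it does leave it, since d is not a recession direction. *)
Lemma tighten_along p x d : feasible x -> d != 0 -> 0 <= p d ->
    (forall j, j \in tight x -> a j d = 0) ->
  exists y, [/\ feasible y, p x <= p y & tight x \proper tight y].
Proof.
move=> fx dN0 pd_ge0 tight_d.
have [j0 aj0] : exists j, 0 < a j d.
  apply/existsP; apply: contraNT dN0 => /existsPn nex; apply/eqP.
  by apply: no_recession => j; rewrite leNgt nex.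
pose ratio j := (b j - a j x) / a j d.
have [j1 aj1 ratio_min] := arg_minP ratio (P := fun j => 0 < a j d) aj0.
have aE j : a j (x + ratio j1 *: d) = a j x + ratio j1 * a j d.
  by rewrite linearD linearZ.
have ratio_ge0 : 0 <= ratio j1 by rewrite divr_ge0 ?subr_ge0 ?fx // ltW.
exists (x + ratio j1 *: d); split.
- move=> j; rewrite aE; have [aj|aj] := ltP 0 (a j d).
    by rewrite -lerBrDl -ler_pdivlMr // ratio_min.
  by rewrite (le_trans _ (fx j)) // gerDl mulr_ge0_le0.
- by rewrite linearD linearZ lerDl mulr_ge0.
- apply/properP; split.
    by apply/subsetP => j jx; move: (jx); rewrite !inE aE tight_d // mulr0 addr0.
  exists j1.
    by rewrite inE aE divfK ?subrKC ?eqxx ?lt0r_neq0.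
  by apply/negP => /tight_d ad0; rewrite ad0 ltxx in aj1.
Qed.

(** Of the two opposite directions that keep the tight constraints tight, one
    does not decrease the objective. *)
Lemma tighten p x : feasible x -> ~ vertex x ->
  exists y, [/\ feasible y, p x <= p y & tight x \proper tight y].
Proof.
move=> fx; case/not_andP => // /existsNP [d /not_implyP [tight_d /eqP dN0]].
have [pd|pd] := leP 0 (p d); first exact: tighten_along fx dN0 pd tight_d.
apply: (@tighten_along p x (- d)) => //; first by rewrite oppr_eq0.
  by rewrite linearN oppr_ge0 ltW.
by move=> j /tight_d; rewrite linearN /= => ->; rewrite oppr0.
Qed.

Lemma vertex_dominates p x : feasible x -> exists2 y, vertex y & p x <= p y.
Proof.
have [k] := ubnP #|~: tight x|; elim: k x => // k IHk x lt_k fx.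
have [vx|/(tighten p fx) [y [fy pxy ltT]]] := EM (vertex x); first by exists x.
have [|z vz pyz] := IHk y _ fy; last by exists z => //; apply: le_trans pyz.
by apply: leq_trans (lt_k : (_ <= k)%N); rewrite proper_card ?properC.
Qed.

Lemma lp_vertex_optimum p x0 : feasible x0 ->
  exists2 x, vertex x & forall y, feasible y -> p y <= p x.
Proof.
move=> fx0; have [v0 vv0 _] := vertex_dominates p fx0.
(* The vertices are enumerated by their tight sets; the default value v0 of
   xget stands for the sets that are tight at no vertex. *)
pose vertex_at S := xget v0 [set x | vertex x /\ tight x = S]%classic.
have vertex_atP S : vertex (vertex_at S).
  by rewrite /vertex_at; case: xgetP => [x _ []|].
have vertex_atE x : vertex x -> vertex_at (tight x) = x.
  move=> vx; apply: xget_unique => // y [vy eqT].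
  exact: tight_vertex_inj eqT.
have [S _ max_S] := arg_maxP (fun S => p (vertex_at S)) (P := predT)
  (erefl : predT (tight v0)).
exists (vertex_at S) => // y /(vertex_dominates p) [z vz pyz].
by rewrite (le_trans pyz) // -(vertex_atE z vz); apply: max_S.
Qed.

End Vertices.

(** Evaluated on the standard basis, the tight constraints form a matrix with
    n rows, whose left kernel is trivial because x is a vertex; so it has at
    least n columns. *)
Lemma dim_le_tight (R : realFieldType) n (J : finType)
    (a : J -> {scalar 'rV[R]_n}) (b : J -> R) x :
  vertex a b x -> (n <= #|tight a b x|)%N.
Proof.
move=> [_ rigid].
pose M := \matrix_(i < n, k < #|tight a b x|) a (enum_val k) (delta_mx 0 i).
suff : row_free M.
  by rewrite -row_leq_rank => /leq_trans -> //; apply: rank_leq_col.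
apply: inj_row_free => d dM0; apply: rigid => j jx.
have <- : (d *m M) 0 (enum_rank_in jx j) = a j d.
  rewrite [in RHS](row_sum_delta d) linear_sum mxE; apply: eq_bigr => i _.
  by rewrite mxE enum_rankK_in // linearZ.
by rewrite dM0 mxE.
Qed.

(** * The colored knapsack *)

Section Dot.
Variables (R : realFieldType) (n : nat).

Definition dot (u : 'I_n -> R) (x : 'rV[R]_n) : R := \sum_i u i * x 0 i.

Fact dot_is_scalar u : scalar (dot u).
Proof.
move=> k x y; rewrite /dot mulr_sumr -big_split /=.
by apply: eq_bigr => i _; rewrite !mxE mulrDr mulrCA.
Qed.

HB.instance Definition _ u :=
  GRing.isLinear.Build R 'rV[R]_n R _ (dot u) (dot_is_scalar u).

End Dot.

Section ColoredKnapsack.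
Variables (R : realType) (n m : nat) (K : ckp_instance n m).
Implicit Types x : 'rV[R]_n.

(** [inl None] is the capacity, [inl (Some c)] the color constraint of [c], and
    [inr (i, s)] the upper ([s = true]) or lower bound of the variable [i]. *)
Definition ckp_constraint : finType := (option 'I_m + 'I_n * bool)%type.

Definition ckp_form (j : ckp_constraint) : {scalar 'rV[R]_n} :=
  match j with
  | inl None => dot (fun i => (weight K i)%:~R)
  | inl (Some c) => dot (fun i => if color K i == c then 1 else -1)
  | inr (i, s) => dot (fun k => if k == i then (-1) ^+ (~~ s) else 0)
  end.

Definition ckp_bound (j : ckp_constraint) : R :=
  match j with
  | inl None => (capacity K)%:~R
  | inl (Some _) => 1
  | inr (_, s) => s%:R
  end.

Lemma ckp_form_color c x : ckp_form (inl (Some c)) x =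
  \sum_(i in color_class K c) x 0 i - \sum_(i in ~: color_class K c) x 0 i.
Proof.
rewrite /= /dot (bigID (fun i => color K i == c)) /= -sumrN; congr (_ + _).
  by apply: eq_big => [i|i ->]; rewrite ?inE ?mul1r.
by apply: eq_big => [i|i /negPf ->]; rewrite ?inE ?mulN1r.
Qed.

Lemma ckp_form_side i s x : ckp_form (inr (i, s)) x = (-1) ^+ (~~ s) * x 0 i.
Proof.
rewrite /= /dot (bigD1 i) //= eqxx big1 ?addr0 // => k /negPf ->.
by rewrite mul0r.
Qed.

Lemma ckp_feasibleP x : feasible ckp_form ckp_bound x <-> lp_feasible K x.
Proof.
split=> [fx|[cap_x col_x box_x]].
  split; first exact: (fx (inl None)).
    by move=> c; rewrite -ckp_form_color; apply: fx (inl (Some c)).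
  move=> i; have := fx (inr (i, true)); have := fx (inr (i, false)).
  by rewrite !ckp_form_side /= mulN1r mul1r oppr_le0 => -> ->.
case=> [[c|]|[i s]]; [by rewrite ckp_form_color | exact: cap_x |].
rewrite ckp_form_side; have /andP[x_ge0 x_le1] := box_x i.
by case: s => /=; rewrite ?mul1r // mulN1r oppr_le0.
Qed.

Lemma ckp_no_recession (d : 'rV[R]_n) : (forall j, ckp_form j d <= 0) -> d = 0.
Proof.
move=> rec; apply/rowP => i; rewrite mxE.
have := rec (inr (i, true)); have := rec (inr (i, false)).
rewrite !ckp_form_side /= mulN1r mul1r oppr_le0 => d_ge0 d_le0.
by apply/eqP; rewrite eq_le d_le0.
Qed.

(** For distinct colors the coefficients of the two constraints cancel on the
    items of both colors and add up to -2 on all other items, so the two left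
    sides, both equal to 1, have a nonpositive sum. *)
Lemma tight_color_unique x c c' : (forall i, 0 <= x 0 i) ->
  ckp_form (inl (Some c)) x = 1 -> ckp_form (inl (Some c')) x = 1 -> c = c'.
Proof.
move=> x_ge0 tc tc'; apply/eqP; apply: contraT => neq_cc'.
suff : (1 + 1 : R) <= 0 by rewrite leNgt addr_gt0 ?ltr01.
rewrite -{1}tc -tc' /= /dot -big_split /=; apply: sumr_le0 => i _.
rewrite -mulrDl mulr_le0_ge0 //.
case: eqP => [->|_]; first by rewrite (negPf neq_cc') subrr.
by case: eqP => _; rewrite ?addNr // -opprD oppr_le0 addr_ge0 ?ler01.
Qed.

Lemma vertex_fractional_le2 x :
  vertex ckp_form ckp_bound x -> (#|fractional_items x| <= 2)%N.
Proof.
move=> vx; have [_ _ box_x] := (ckp_feasibleP x).1 vx.1.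
pose T := tight ckp_form ckp_bound x.
pose tight_colors := [set c | inl (Some c) \in T].
(* The only side of a non-fractional item that can be tight. *)
pose side i : ckp_constraint := inr (i, 0 < x 0 i).
have T_sub : T \subset [set inl None] :|: (inl \o Some) @: tight_colors
                       :|: side @: ~: fractional_items x.
  apply/subsetP => -[[c|]|[i s]] jT; apply/setUP.
  - by left; apply/setUP; right; apply/imsetP; exists c; rewrite // inE.
  - by left; apply/setUP; left; apply: set11.
  have xi : x 0 i = s%:R.
    move: jT; rewrite inE ckp_form_side => /eqP /=.
    by case: s => /=; rewrite ?mul1r // mulN1r => /eqP; rewrite oppr_eq0 => /eqP.
  right; apply/imsetP; exists i.
    by rewrite !inE xi; case: (s); rewrite ?ltxx ?andbF.
  by rewrite /side xi; case: (s); rewrite ?ltr01 ?ltxx.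
have colors_le1 : (#|tight_colors| <= 1)%N.
  apply/card_le1_eqP => c c'; rewrite !inE => /eqP tc /eqP tc'.
  by apply: (tight_color_unique _ tc' tc) => i; case/andP: (box_x i).
have n_le := leq_trans (dim_le_tight vx) (subset_leq_card T_sub).
rewrite -(leq_add2r #|~: fractional_items x|) cardsC card_ord.
apply: leq_trans n_le (leq_trans (leq_card_setU _ _) _).
apply: leq_add (leq_imset_card _ _).
apply: leq_trans (leq_card_setU _ _) _; rewrite cards1 -[2%N]/(1 + 1)%N leq_add2l.
exact: leq_trans (leq_imset_card _ _) colors_le1.
Qed.

End ColoredKnapsack.

Theorem lemma1 (R : realType) (n m : nat) (K : ckp_instance n m) :
  exists x : 'rV[R]_n, lp_optimal K x /\ (#|fractional_items x| <= 2)%N.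
Proof.
have feasible0 : feasible (ckp_form R K) (ckp_bound R K) 0.
  move=> j; rewrite linear0; case: j => [[c|]|[i s]] /=; rewrite ?ler01 ?ler0n //.
  by rewrite ler0z ltW // capacity_gt0.
have [x vx max_x] := lp_vertex_optimum (@ckp_no_recession R n m K)
  (dot (fun i => (profit K i)%:~R)) feasible0.
exists x; split; last exact: vertex_fractional_le2 vx.
split; first exact/ckp_feasibleP/vx.1.
by move=> y /ckp_feasibleP; apply: max_x.
Qed.
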